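(* Let $X$ and $Y$ be random variables with values in finite sets $\mathbb{X}$ and $\mathbb{Y}$, $|\mathbb{X}|>1$, $|\mathbb{Y}|>1$, with joint distribution $P_{X,Y}$ such that $P_X(x)>0$ for all $x\in\mathbb{X}$ and $P_Y(y)>0$ for all $y\in\mathbb{Y}$. Suppose that the posterior is strictly positive: $P_{Y\mid X}(y\mid x)>0$ for all $x\in\mathbb{X}$, $y\in\mathbb{Y}$. Let $Z=f_E(X)$ be the output of a (possibly randomized) feature map $f_E$, let $\gamma$ be a real number and let $\alpha\in\{1,\infty\}$. Then the following two properties cannot hold at the same time: 1. $Z=f_E(X)$ satisfies the unconditional least-privilege principle (unconditional LPP) with parameter $\gamma$; 2. $I_\alpha(Y;Z)>\gamma$.
   Context: All logarithms are base 2. A feature map $f_E$ from $\mathbb{X}$ to a finite set $\mathbb{Z}$ is given by a conditional distribution $P_{Z\mid X}$; the representation $Z=f_E(X)$ is drawn from $P_{Z\mid X}(\cdot\mid X)$ using randomness independent of $Y$ given $X$, so $Y - X - Z$ is a Markov chain. For random variables $A,B,C$, ''$A-B-C$ is a Markov chain'' means that $A$ and $C$ are conditionally independent given $B$. For a random variable $S$ with values in a finite set $\mathbb{S}$ and a random variable $W$ with values in a finite set $\mathbb{W}$, $\hat S(W)$ denotes the Bayes-optimal guess of $S$ from $W$, so $\Pr[S=\hat S(W)]=\max_{g:\mathbb{W}\to\mathbb{S}}\Pr[S=g(W)]$. $\hat S$ without argument denotes the majority guess, so $\Pr[S=\hat S]=\max_{s\in\mathbb{S}}\Pr[S=s]$.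 Utility: $I_1(Y;Z)$ is Shannon's mutual information (in bits), and $I_\infty(Y;Z)=\log\frac{\Pr[Y=\hat Y(Z)]}{\Pr[Y=\hat Y]}$ (Arimoto's information of order $\infty$). Unconditional LPP: given $P_{X,Y}$, the feature map $Z=f_E(X)$ satisfies the unconditional LPP with parameter $\gamma$ if, for every random variable (attribute) $S$ with values in a finite set (jointly distributed with $(X,Y,Z)$) such that $S\neq Y$ (as random variables, i.e. $S$ is not almost surely equal to $Y$) and $S-X-Z$ is a Markov chain, $$\frac{\Pr[S=\hat S(Z)]}{\Pr[S=\hat S]}\le 2^\gamma .$$ *)

(* Defs.v *)
From HB Require Import structures.
From Stdlib Require Import JMeq.
From mathcomp Require Import all_boot all_order all_algebra.
From mathcomp Require Import boolp reals exp.

Set Implicit Arguments.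
Unset Strict Implicit.
Unset Printing Implicit Defensive.

Import Order.TTheory GRing.Theory Num.Theory.
Local Open Scope ring_scope.

Record fdist (R : realType) (T : finType) := FDist {
  pmf :> T -> R;
  pmf_ge0 : forall t, 0 <= pmf t;
  pmf_sum1 : \sum_(t : T) pmf t = 1
}.

Section FiniteProbability.
Variable R : realType.

Definition log2 (x : R) : R := ln x / ln 2.

Definition Pr (W : finType) (P : fdist R W) (A : pred W) : R :=
  \sum_(w | A w) P w.

Definition cPr (W : finType) (P : fdist R W) (A B : pred W) : R :=
  Pr P [pred w | A w && B w] / Pr P B.

(* Random variables are functions on a finite sample space W. *)
Definition markov_chain (W A B C : finType) (P : fdist R W)
    (U : W -> A) (V : W -> B) (T : W -> C) : Prop :=
  forall a b c, 0 < Pr P [pred w | V w == b] ->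
    cPr P [pred w | (U w == a) && (T w == c)] [pred w | V w == b] =
    cPr P [pred w | U w == a] [pred w | V w == b] *
    cPr P [pred w | T w == c] [pred w | V w == b].

(* The two variables may have different alphabets A and B, so their values are
   compared by heterogeneous equality: it is ordinary equality if A and B are
   the same type, and values of different types are never equal. *)
Definition as_equal (W A B : finType) (P : fdist R W)
    (U : W -> A) (V : W -> B) : Prop :=
  Pr P [pred w | `[< JMeq (U w) (V w) >]] = 1.

(* In both maxima the default value 0 plays no role: the probabilities are
   nonnegative, and the alphabets are nonempty because W carries P. *)
Definition majority_prob (W A : finType) (P : fdist R W) (U : W -> A) : R :=
  \big[Num.max/0]_(a : A) Pr P [pred w | U w == a].

Definition bayes_prob (W A B : finType) (P : fdist R W)
    (U : W -> A) (V : W -> B) : R :=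
  \big[Num.max/0]_(g : {ffun B -> A}) Pr P [pred w | U w == g (V w)].

(* As ln 0 = 0 here and x / 0 = 0, pairs of probability zero contribute 0. *)
Definition mutual_info (W A B : finType) (P : fdist R W)
    (U : W -> A) (V : W -> B) : R :=
  \sum_(a : A) \sum_(b : B)
    Pr P [pred w | (U w == a) && (V w == b)] *
    log2 (Pr P [pred w | (U w == a) && (V w == b)] /
          (Pr P [pred w | U w == a] * Pr P [pred w | V w == b])).

Definition arimoto_info_infty (W A B : finType) (P : fdist R W)
    (U : W -> A) (V : W -> B) : R :=
  log2 (bayes_prob P U V / majority_prob P U).

Variant info_order := order_one | order_infty.

Definition utility (alpha : info_order) (W A B : finType) (P : fdist R W)
    (U : W -> A) (V : W -> B) : R :=
  match alpha with
  | order_one => mutual_info P U V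
  | order_infty => arimoto_info_infty P U V
  end.

Section FeatureMap.
Variables X Y Z : finType.
Variables (P : fdist R (X * Y)%type) (E : X -> fdist R Z).

Definition joint_pmf (w : X * Y * Z) : R := P w.1 * E w.1.1 w.2.

Lemma joint_pmf_ge0 w : 0 <= joint_pmf w.
Proof. by rewrite mulr_ge0 ?pmf_ge0. Qed.

Lemma joint_pmf_sum1 : \sum_w joint_pmf w = 1.
Proof.
rewrite -(pair_bigA _ (fun xy z => joint_pmf (xy, z))) /= -[RHS](pmf_sum1 P).
by apply: eq_bigr => xy _; rewrite /joint_pmf /= -mulr_sumr pmf_sum1 mulr1.
Qed.

(* The law of (X, Y, Z) when Z is drawn from E(. | X), given X independently
   of Y. *)
Definition joint : fdist R (X * Y * Z)%type :=
  FDist joint_pmf_ge0 joint_pmf_sum1.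

(* An attribute with alphabet S is given by the joint law Q of
   (S, (X, Y, Z)), whose second marginal must be the law of (X, Y, Z). *)
Definition unconditional_LPP (gamma : R) : Prop :=
  forall (S : finType) (Q : fdist R (S * (X * Y * Z))%type),
    let rvS := fun w : S * (X * Y * Z) => w.1 in
    let rvX := fun w : S * (X * Y * Z) => w.2.1.1 in
    let rvY := fun w : S * (X * Y * Z) => w.2.1.2 in
    let rvZ := fun w : S * (X * Y * Z) => w.2.2 in
    (forall v, Pr Q [pred w | w.2 == v] = joint v) ->
    ~ as_equal Q rvS rvY ->
    markov_chain Q rvS rvX rvZ ->
    bayes_prob Q rvS rvZ / majority_prob Q rvS <= 2 `^ gamma.

End FeatureMap.
End FiniteProbability.

(* Main.v *)
(** Both utilities are at most the logarithm of the maximal leakage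
    [L = sum_z max_x P(z|x)], because the likelihood [P(z|y)] is an average of
    the [P(z|x)].  Conversely some attribute attains [L]: split every [x] into
    atoms of mass at most [p = min_x P(x)], one of which has mass exactly [p].
    No guess of the atom without [Z] succeeds with probability more than [p],
    while guessing the full atom of the likeliest [x] given [Z = z] succeeds
    with probability [p * L].  Hence the LPP forces [L <= 2^gamma]. *)

Require Import Defs.
From Stdlib Require Import JMeq.
From mathcomp Require Import all_boot all_order all_algebra.
From mathcomp Require Import boolp reals exp.
From mathcomp Require Import ring lra.

Set Implicit Arguments.
Unset Strict Implicit.
Unset Printing Implicit Defensive.

Import Order.TTheory GRing.Theory Num.Theory.
Local Open Scope ring_scope.

(** * Elementary rules for probabilities of events *)

Lemma Pr_ge0 (R : realType) (W : finType) (P : fdist R W) (A : pred W) :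
  0 <= Pr P A.
Proof. by apply: sumr_ge0 => w _; exact: pmf_ge0. Qed.

Lemma eq_Pr (R : realType) (W : finType) (P : fdist R W) (A B : pred W) :
  A =1 B -> Pr P A = Pr P B.
Proof. exact: eq_bigl. Qed.

Lemma PrT (R : realType) (W : finType) (P : fdist R W) : Pr P predT = 1.
Proof. exact: pmf_sum1. Qed.

Lemma Pr1 (R : realType) (W : finType) (P : fdist R W) (t : W) :
  Pr P (pred1 t) = P t.
Proof. by rewrite /Pr big_pred1_eq. Qed.

Lemma Pr_total (R : realType) (W B : finType) (P : fdist R W) (A : pred W)
    (V : W -> B) :
  Pr P A = \sum_b Pr P [pred w | A w && (V w == b)].
Proof. by rewrite /Pr (partition_big V predT). Qed.

(** * Bounds on both utilities from dominated likelihoods *)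

Section InformationBounds.
Variables (R : realType) (W A B : finType) (P : fdist R W).
Variables (U : W -> A) (V : W -> B) (m : B -> R).
Hypothesis m_ge0 : forall b, 0 <= m b.
Hypothesis likelihood_le : forall a b,
  Pr P [pred w | (U w == a) && (V w == b)] <= Pr P [pred w | U w == a] * m b.

Let pU a := Pr P [pred w | U w == a].
Let pV b := Pr P [pred w | V w == b].
Let pUV a b := Pr P [pred w | (U w == a) && (V w == b)].

Let pU_sum a : pU a = \sum_b pUV a b.
Proof. exact: Pr_total. Qed.

Let pV_sum b : pV b = \sum_a pUV a b.
Proof.
rewrite /pV (Pr_total _ _ U); apply: eq_bigr => a _.
by apply: eq_Pr => w /=; rewrite andbC.
Qed.

Let pU_sum1 : \sum_a pU a = 1.
Proof. by rewrite -[RHS](PrT P) (Pr_total _ _ U). Qed.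

Let pV_sum1 : \sum_b pV b = 1.
Proof. by rewrite -[RHS](PrT P) (Pr_total _ _ V). Qed.

(** Sum [likelihood_le] over all [a] and [b]: the left side has total mass 1. *)
Lemma likelihood_bound_ge1 : 1 <= \sum_b m b.
Proof.
rewrite -[leRHS]mul1r -pU_sum1 mulr_suml; apply: ler_sum => a _.
by rewrite {1}pU_sum mulr_sumr; apply: ler_sum => b _; exact: likelihood_le.
Qed.

Let L_gt0 : 0 < \sum_b m b.
Proof. exact: lt_le_trans likelihood_bound_ge1. Qed.

Let ln2_gt0 : 0 < ln (2 : R).
Proof. by rewrite ln_gt0 // ltr1n. Qed.

(** A guess [g] succeeds with probability [\sum_b pUV (g b) b], and each term is at most the
    majority probability times [m b]. *)
Lemma arimoto_info_infty_le : arimoto_info_infty P U V <= log2 (\sum_b m b).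
Proof.
rewrite /arimoto_info_infty /log2 ler_pM2r ?invr_gt0 //.
(* A nonpositive ratio has logarithm 0 by convention, which is at most [ln L] because [L >= 1]. *)
have [r_gt0|r_le0] := ltP 0 (bayes_prob P U V / majority_prob P U); last first.
  by rewrite (ln0 r_le0) ln_ge0 // likelihood_bound_ge1.
rewrite ler_ln ?posrE //.
have maj_ge a : pU a <= majority_prob P U by apply: le_bigmax.
have maj_gt0 : 0 < majority_prob P U.
  rewrite lt_neqAle eq_sym bigmax_ge_id andbT; apply: contraTneq r_gt0 => ->.
  by rewrite invr0 mulr0 ltxx.
rewrite ler_pdivrMr //; apply: bigmax_le => [|g _].
  by rewrite mulr_ge0 // ltW.
rewrite (Pr_total _ _ V) mulr_suml; apply: ler_sum => b _.
rewrite (_ : Pr _ _ = pUV (g b) b); last first.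
  by apply: eq_Pr => w /=; case: (V w =P b) => [->|_]; rewrite ?andbF.
apply: le_trans (likelihood_le _ _) _.
by rewrite mulrC ler_wpM2l ?m_ge0 ?maj_ge.
Qed.

(* The tangent bound [ln t <= ln L + t / L - 1], for [L] the sum of the [m b],
   applied to each likelihood ratio. *)
Let mutual_info_term_le a b :
  pUV a b * ln (pUV a b / (pU a * pV b)) <=
  pUV a b * (ln (\sum_b m b) - 1) + pUV a b / pV b * (m b / \sum_b m b).
Proof.
set L := \sum_b m b.
have [->|pUV_neq0] := eqVneq (pUV a b) 0; first by rewrite !mul0r addr0.
have pUV_gt0 : 0 < pUV a b by rewrite lt_neqAle eq_sym pUV_neq0 Pr_ge0.
have pU_gt0 : 0 < pU a.
  apply: lt_le_trans pUV_gt0 _; rewrite pU_sum (bigD1 b) //= lerDl.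
  by apply: sumr_ge0 => ? _; exact: Pr_ge0.
have pV_gt0 : 0 < pV b.
  apply: lt_le_trans pUV_gt0 _; rewrite pV_sum (bigD1 a) //= lerDl.
  by apply: sumr_ge0 => ? _; exact: Pr_ge0.
rewrite -mulrA -mulrDr ler_pM2l //.
set t := pUV a b / _.
have t_gt0 : 0 < t by rewrite divr_gt0 ?mulr_gt0.
(* The likelihood hypothesis, divided by [pU a * pV b], bounds [t] by [m b / pV b]. *)
have t_le : t / L <= (pV b)^-1 * (m b / L).
  rewrite mulrA ler_pM2r ?invr_gt0 // ler_pdivrMr ?mulr_gt0 //.
  rewrite [leRHS](_ : _ = pU a * m b); first exact: likelihood_le.
  by field; rewrite gt_eqF.
have : ln (t / L) <= t / L - 1.
  rewrite -[X in ln X](subrK 1) addrC le_ln1Dx // ltrBrDl subrr.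
  exact: divr_gt0.
by rewrite ln_div ?posrE //; lra.
Qed.

Lemma mutual_info_le : mutual_info P U V <= log2 (\sum_b m b).
Proof.
rewrite /mutual_info /log2 ler_pdivlMr // mulr_suml.
under eq_bigr => a _ do rewrite mulr_suml.
rewrite exchange_big /=.
set L := \sum_b m b.
(* The weights [pV b] and [m b / L] both have total mass 1; splitting [ln L] along them allows a
   comparison for each [b]. *)
have -> : ln L = \sum_b (pV b * (ln L - 1) + m b / L).
  by rewrite big_split /= -!mulr_suml pV_sum1 divff ?gt_eqF // mul1r subrK.
apply: ler_sum => b _.
apply: (@le_trans _ _ (\sum_a (pUV a b * (ln L - 1)
                               + pUV a b / pV b * (m b / L)))).
  apply: ler_sum => a _; apply: le_trans (mutual_info_term_le a b).
  by rewrite /log2 -mulrA mulfVK // gt_eqF.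
rewrite big_split /= -!mulr_suml -pV_sum lerD2l.
(* If [pV b = 0], the quotient by it is 0 by convention, and [0 <= m b / L] remains. *)
have [->|pV_neq0] := eqVneq (pV b) 0; last by rewrite divff // mul1r.
by rewrite !mul0r divr_ge0 // ltW.
Qed.

Lemma utility_le alpha : utility alpha P U V <= log2 (\sum_b m b).
Proof.
by case: alpha; [exact: mutual_info_le | exact: arimoto_info_infty_le].
Qed.

End InformationBounds.

(** * Attributes drawn from a kernel on [X], and their difference from [Y] *)

Lemma JMeq_card (S T : finType) (s : S) (t : T) : JMeq s t -> #|S| = #|T|.
Proof.
move=> st; have ST : (S : Type) = T by case: st.
(* [ST] identifies only the carriers, whose [finType] structures may differ, so the cardinals are
   compared through the injective cast. *)
have le_card (A B : finType) : (A : Type) = B -> (#|A| <= #|B|)%N.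
  move=> AB; apply: (@leq_card _ _ (fun a => ecast C C AB a)).
  by move: (Finite.sort B) AB => C AB; case: _ / AB.
by apply/eqP; rewrite eqn_leq !le_card.
Qed.

Section AttributeKernel.
Variables (R : realType) (X Y Z S : finType).
Variables (P : fdist R (X * Y)%type) (E : X -> fdist R Z).
Variable K : X -> fdist R S.

Let PX x := Pr P [pred w | w.1 == x].

(** Given [X = x], the attribute is drawn from [K x] independently of [Y] and [Z]. *)
Definition attribute_pmf (w : S * (X * Y * Z)) : R :=
  joint P E w.2 * K w.2.1.1 w.1.

Lemma attribute_pmf_ge0 w : 0 <= attribute_pmf w.
Proof. by rewrite mulr_ge0 ?pmf_ge0. Qed.

Lemma attribute_pmf_sum1 : \sum_w attribute_pmf w = 1.
Proof.
rewrite -(pair_bigA _ (fun s v => attribute_pmf (s, v))) exchange_big /=.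
rewrite -[RHS](pmf_sum1 (joint P E)); apply: eq_bigr => v _.
by rewrite /attribute_pmf /= -mulr_sumr pmf_sum1 mulr1.
Qed.

Definition attribute_law : fdist R (S * (X * Y * Z))%type :=
  FDist attribute_pmf_ge0 attribute_pmf_sum1.

Lemma attribute_law_marginal v :
  Pr attribute_law [pred w | w.2 == v] = joint P E v.
Proof.
rewrite /Pr -(pair_big_dep predT (fun _ u => u == v)
  (fun s u => attribute_pmf (s, u))) /=.
under eq_bigr do rewrite big_pred1_eq.
by rewrite /attribute_pmf /= -mulr_sumr pmf_sum1 mulr1.
Qed.

(** Conditional independence of attribute and [Z] given [X], in product form; taking [predT] or
    [pred1] for [f] and [g] yields the probabilities used below. *)
Lemma Pr_attribute_law (f : pred S) (g : pred Z) x :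
  Pr attribute_law [pred w | f w.1 && g w.2.2 && (w.2.1.1 == x)] =
  PX x * (Pr (K x) f * Pr (E x) g).
Proof.
rewrite /Pr big_mkcond /= -(pair_bigA _ (fun s v =>
  if f s && g v.2 && (v.1.1 == x) then attribute_pmf (s, v) else 0)) /=.
rewrite mulrCA mulr_suml [RHS]big_mkcond /=; apply: eq_bigr => s _.
case: (f s) => /=; last by rewrite big1.
rewrite -(pair_bigA _ (fun u z =>
  if g z && (u.1 == x) then attribute_pmf (s, (u, z)) else 0)) /=.
rewrite mulr_suml mulr_sumr [RHS]big_mkcond /=; apply: eq_bigr => u _.
case: eqP => [ux|_]; last by rewrite big1 // => z _; rewrite andbF.
rewrite mulrCA mulrC mulr_sumr mulr_suml [RHS]big_mkcond /=.
apply: eq_bigr => z _; rewrite andbT; case: (g z) => //.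
by rewrite /attribute_pmf /= /joint_pmf /= ux; ring.
Qed.

Lemma attribute_law_markov :
  markov_chain attribute_law (fun w => w.1) (fun w => w.2.1.1) (fun w => w.2.2).
Proof.
move=> s x z; rewrite /cPr.
have -> : Pr attribute_law [pred w | w.2.1.1 == x] = PX x.
  by have := Pr_attribute_law predT predT x; rewrite !PrT !mulr1.
move=> PX_gt0; rewrite (Pr_attribute_law (pred1 s) (pred1 z)).
have -> : Pr attribute_law [pred w | (w.1 == s) && (w.2.1.1 == x)]
          = PX x * K x s.
  have := Pr_attribute_law (pred1 s) predT x; rewrite PrT mulr1 Pr1 => <-.
  by apply: eq_Pr => w /=; rewrite andbT.
have -> : Pr attribute_law [pred w | (w.2.2 == z) && (w.2.1.1 == x)]
          = PX x * E x z.
  by have := Pr_attribute_law predT (pred1 z) x; rewrite PrT mul1r Pr1 => <-.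
by rewrite !Pr1 ![PX x * _]mulrC !mulfK ?gt_eqF.
Qed.

Lemma attribute_law_prob s :
  Pr attribute_law [pred w | w.1 == s] = \sum_x PX x * K x s.
Proof.
rewrite (Pr_total _ _ (fun w => w.2.1.1)); apply: eq_bigr => x _.
have := Pr_attribute_law (pred1 s) predT x; rewrite PrT mulr1 Pr1 => <-.
by apply: eq_Pr => w /=; rewrite andbT.
Qed.

Lemma attribute_law_guess (g : {ffun Z -> S}) :
  Pr attribute_law [pred w | w.1 == g w.2.2] =
  \sum_z \sum_x PX x * (K x (g z) * E x z).
Proof.
rewrite (Pr_total _ _ (fun w => w.2.2)); apply: eq_bigr => z _.
rewrite (Pr_total _ _ (fun w => w.2.1.1)); apply: eq_bigr => x _.
have := Pr_attribute_law (pred1 (g z)) (pred1 z) x; rewrite !Pr1 => <-.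
apply: eq_Pr => w /=; congr (_ && _).
by case: (w.2.2 =P z) => [->|_]; rewrite ?andbF.
Qed.

Lemma attribute_law_not_as_equal : #|S| != #|Y| ->
  ~ as_equal attribute_law (fun w => w.1) (fun w => w.2.1.2).
Proof.
move=> card_neq; rewrite /as_equal /Pr big_pred0 => [/esym/eqP|w /=].
  by rewrite oner_eq0.
by apply/asboolP => /JMeq_card /eqP; apply/negP.
Qed.

End AttributeKernel.

(** * The shattered attribute and its consequence for the leakage *)

Section Shattering.
Variables (R : realType) (X Y Z : finType).
Variables (P : fdist R (X * Y)%type) (E : X -> fdist R Z).

Let PX x := Pr P [pred w | w.1 == x].
Hypothesis PX_gt0 : forall x, 0 < PX x.

Variables (p : R) (n : nat).
Hypothesis p_gt0 : 0 < p.
Hypothesis p_le : forall x, p <= PX x.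
Hypothesis n_ge : 1 <= p * n.+1%:R.

(* Given [X = x], the attribute is [(x, i)]: the atom [(x, ord0)] has
   unconditional mass [p], and the other [n.+1] atoms share [PX x - p]. *)
Definition shatter_pmf (x : X) (s : X * 'I_n.+2) : R :=
  if s.1 == x then
    (if s.2 == ord0 then p else (PX x - p) / n.+1%:R) / PX x
  else 0.

Lemma shatter_pmf_ge0 x s : 0 <= shatter_pmf x s.
Proof.
rewrite /shatter_pmf; case: eqP => // _; rewrite divr_ge0 ?(ltW (PX_gt0 _)) //.
by case: eqP => _; [exact: ltW | rewrite divr_ge0 ?subr_ge0].
Qed.

Lemma shatter_pmf_sum1 x : \sum_s shatter_pmf x s = 1.
Proof.
rewrite -(pair_bigA _ (fun x' i => shatter_pmf x (x', i))) (bigD1 x) //=.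
rewrite [X in _ + X]big1 => [|x' /negPf x'x]; last first.
  by rewrite big1 // => i _; rewrite /shatter_pmf /= x'x.
rewrite addr0 /shatter_pmf /= eqxx -mulr_suml big_ord_recl /=.
rewrite sumr_const card_ord -[X in p + X]mulr_natr mulfVK ?pnatr_eq0 //.
by rewrite addrC subrK divff ?gt_eqF.
Qed.

Definition shatter (x : X) : fdist R (X * 'I_n.+2)%type :=
  FDist (shatter_pmf_ge0 x) (shatter_pmf_sum1 x).

Let Q := attribute_law P E shatter.

(** An atom with index other than [ord0] has mass [(PX x - p) / n.+1], at most [1 / n.+1], hence at
    most [p] by [n_ge]. *)
Lemma shatter_majority_le : majority_prob Q (fun w => w.1) <= p.
Proof.
apply: bigmax_le => [|s _]; first exact: ltW.
rewrite attribute_law_prob (bigD1 s.1) //= big1 => [|x /negPf xs]; last first.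
  by rewrite /shatter_pmf eq_sym xs mulr0.
rewrite addr0 /shatter_pmf eqxx mulrC mulfVK ?(gt_eqF (PX_gt0 _)) //; case: eqP => // _.
rewrite ler_pdivrMr ?ltr0n //; apply: le_trans n_ge.
rewrite lerBlDr ler_wpDr ?(ltW p_gt0) // -[leRHS](PrT P).
rewrite (Pr_total _ _ fst) (bigD1 s.1) //= lerDl.
by apply: sumr_ge0 => ? _; exact: Pr_ge0.
Qed.

Lemma shatter_bayes_ge (xs : Z -> X) :
  p * \sum_z E (xs z) z <= bayes_prob Q (fun w => w.1) (fun w => w.2.2).
Proof.
(* For each [z], the input [xs z] alone contributes [p * E (xs z) z], since [PX (xs z)] cancels. *)
pose g := [ffun z => (xs z, ord0 : 'I_n.+2)].
apply: le_trans (le_bigmax _ _ g); rewrite attribute_law_guess mulr_sumr.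
apply: ler_sum => z _; rewrite (bigD1 (xs z)) //= ler_wpDr //.
  by apply: sumr_ge0 => x _; rewrite !mulr_ge0 ?Pr_ge0 ?shatter_pmf_ge0 ?pmf_ge0.
by rewrite ffunE /shatter_pmf !eqxx mulrA [PX _ * _]mulrC mulfVK ?gt_eqF.
Qed.

Lemma shatter_majority_gt0 : 0 < majority_prob Q (fun w => w.1).
Proof.
(* An empty [X] would contradict the total mass 1 of [P]. *)
have [x _|X0] := pickP (fun _ : X => true).
  apply: lt_le_trans (le_bigmax _ _ (x, ord0)).
  rewrite attribute_law_prob (bigD1 x) //= ltr_wpDr //.
    by apply: sumr_ge0 => x' _; rewrite mulr_ge0 ?Pr_ge0 ?shatter_pmf_ge0.
  by rewrite mulr_gt0 ?PX_gt0 // /shatter_pmf !eqxx divr_gt0.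
have := pmf_sum1 P; rewrite big1 => [/esym/eqP|[x y] _]; first by rewrite oner_eq0.
by have := X0 x.
Qed.

End Shattering.

(** For the shattered attribute the Bayes probability is at least [p] times the sum and the majority
    probability at most [p], so [p] cancels in the ratio that the LPP bounds. *)
Lemma unconditional_LPP_leakage (R : realType) (X Y Z : finType)
    (P : fdist R (X * Y)%type) (E : X -> fdist R Z) (gamma : R) (xs : Z -> X) :
  (forall x, 0 < Pr P [pred w | w.1 == x]) ->
  unconditional_LPP P E gamma -> \sum_z E (xs z) z <= 2 `^ gamma.
Proof.
move=> PX_gt0 LPP; pose PX x := Pr P [pred w | w.1 == x].
pose p := \big[Num.min/1]_x PX x.
have p_gt0 : 0 < p by apply/bigmin_gtP; split => // x _; exact: PX_gt0.
have p_le x : p <= PX x by exact: bigmin_le.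
(* The summand [#|Y|] gives the attribute more values than [Y] has, so that it
   is not equal to [Y]. *)
pose n := (Num.truncn p^-1 + #|Y|)%N.
(* Truncation plus one exceeds [p^-1]. *)
have n_ge : 1 <= p * n.+1%:R.
  rewrite -ler_pdivrMl // mulr1; apply: ltW.
  apply: lt_le_trans (truncnS_gt _) _; rewrite ler_nat ltnS; exact: leq_addr.
(* For empty [Z] the sum is 0; otherwise [xs z] shows that [X] is inhabited, which the cardinality
   comparison uses. *)
have [z _|Z0] := pickP (fun _ : Z => true); last first.
  by rewrite big_pred0 // powR_ge0.
have card_neq : #|{: X * 'I_n.+2}| != #|Y|.
  have X_gt0 : (0 < #|X|)%N by apply/card_gt0P; exists (xs z).
  rewrite gt_eqF // ltEnat /= card_prod card_ord.
  apply: leq_trans (leq_pmull _ X_gt0).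
  by rewrite !ltnS -addnS; apply: leq_trans (leq_addl _ _).
have := LPP _ _ (attribute_law_marginal P E (shatter PX_gt0 n p_gt0 p_le))
  (attribute_law_not_as_equal card_neq) (@attribute_law_markov _ _ _ _ _ _ _ _).
apply: le_trans; rewrite ler_pdivlMr ?shatter_majority_gt0 //.
apply: le_trans (shatter_bayes_ge E PX_gt0 n p_gt0 p_le xs).
rewrite mulrC ler_wpM2r //; last exact: shatter_majority_le.
by apply: sumr_ge0 => ? _; exact: pmf_ge0.
Qed.

Lemma joint_prob_YZ (R : realType) (X Y Z : finType)
    (P : fdist R (X * Y)%type) (E : X -> fdist R Z) y z :
  Pr (joint P E) [pred w | (w.1.2 == y) && (w.2 == z)] =
  \sum_(w | w.2 == y) P w * E w.1 z.
Proof.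
rewrite /Pr -(pair_big_dep (fun u : X * Y => u.2 == y) (fun _ z' => z' == z)
  (fun u z' => joint_pmf P E (u, z'))) /=.
by apply: eq_bigr => u _; rewrite big_pred1_eq.
Qed.

(** With [joint_prob_YZ], this exhibits the likelihood of [z] given [y] as an average of the
    [E x z]. *)
Lemma joint_prob_Y (R : realType) (X Y Z : finType)
    (P : fdist R (X * Y)%type) (E : X -> fdist R Z) y :
  Pr (joint P E) [pred w | w.1.2 == y] = \sum_(w | w.2 == y) P w.
Proof.
rewrite (Pr_total _ _ snd).
under eq_bigr => z _ do rewrite joint_prob_YZ.
rewrite exchange_big /=; apply: eq_bigr => w _.
by rewrite -mulr_sumr pmf_sum1 mulr1.
Qed.

Theorem theorem1 (R : realType) (X Y Z : finType)
    (P : fdist R (X * Y)%type) (E : X -> fdist R Z)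
    (gamma : R) (alpha : info_order)
    (card_X : (1 < #|X|)%N) (card_Y : (1 < #|Y|)%N)
    (PX_gt0 : forall x : X, 0 < Pr P [pred w | w.1 == x])
    (PY_gt0 : forall y : Y, 0 < Pr P [pred w | w.2 == y])
    (posterior_gt0 : forall (x : X) (y : Y),
      0 < cPr P [pred w | w.2 == y] [pred w | w.1 == x]) :
  ~ (unconditional_LPP P E gamma /\
     gamma < utility alpha (joint P E)
               (fun w : X * Y * Z => w.1.2) (fun w : X * Y * Z => w.2)).
Proof.
move=> [LPP]; apply/negP; rewrite -leNgt.
have /card_gt0P[x0 _] : (0 < #|X|)%N by exact: ltnW.
(* [xs z] is an input most likely to produce [z], so the sum of the [E (xs z) z] is the leakage
   [L]. *)
pose xs z := [arg max_(x > x0) E x z]%O.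
have E_le x z : E x z <= E (xs z) z.
  by rewrite /xs; case: Order.TotalTheory.arg_maxP => // i _; exact.
have m_ge0 z : 0 <= E (xs z) z by exact: pmf_ge0.
have likelihood_le y z :
    Pr (joint P E) [pred w | (w.1.2 == y) && (w.2 == z)] <=
    Pr (joint P E) [pred w | w.1.2 == y] * E (xs z) z.
  rewrite joint_prob_YZ joint_prob_Y mulr_suml; apply: ler_sum => w _.
  by rewrite ler_wpM2l ?pmf_ge0.
apply: le_trans (utility_le m_ge0 likelihood_le alpha) _.
have L_gt0 : 0 < \sum_z E (xs z) z.
  exact: lt_le_trans (likelihood_bound_ge1 likelihood_le).
rewrite /log2 ler_pdivrMr ?ln_gt0 ?ltr1n // -ln_powR ler_ln ?posrE ?powR_gt0 //.
exact: unconditional_LPP_leakage.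
Qed.
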